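(* Assume that (1) the chain with kernel $p$ has a unique stationary distribution $\mu$ and $\mu(U)>0$ for every non-empty (relatively) open $U\subseteq\mathcal S$; (2) $\sup_{s\in\mathcal S}\|x(s)\|<\infty$ and $\sup_{s\in\mathcal S}|r(s)|<\infty$. Then for any $w\in\mathcal W_*$ and any $w'\in\mathbb R^d$, $$v_w=v_{w'}\ \ \mu\text{-a.e.}\iff w'\in\mathcal W_*.$$
   Context: Setting: $K,d\in\mathbb N$; $\mathcal S\subseteq\mathbb R^K$ with its Borel $\sigma$-algebra; $p(\cdot\mid s)$ is a Markov transition kernel on $\mathcal S$; $r:\mathcal S\to\mathbb R$ is measurable; $\gamma\in[0,1)$; $x:\mathcal S\to\mathbb R^d$ is a measurable feature map (no linear independence is assumed). $(P_\pi f)(s)=\int_{\mathcal S}f(s')\,p(ds'\mid s)$. A stationary distribution is a probability measure $\mu$ with $\mu(Z)=\int_{\mathcal S}p(Z\mid s)\mu(ds)$ for all Borel $Z\subseteq\mathcal S$. $A=\int_{\mathcal S}x(s)\left(\gamma(P_\pi x)(s)^\top-x(s)^\top\right)\mu(ds)\in\mathbb R^{d\times d}$, $b=\int_{\mathcal S}x(s)r(s)\mu(ds)\in\mathbb R^d$, $\mathcal W_*=\{w\in\mathbb R^d: Aw+b=0\}$. For $w\in\mathbb R^d$, $v_w(s)=x(s)^\top w$. *)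

(* Defs.v *)
From HB Require Import structures.
From mathcomp Require Import all_boot all_order all_algebra.
From mathcomp Require Import all_classical all_reals all_analysis.

Set Implicit Arguments.
Unset Strict Implicit.
Unset Printing Implicit Defensive.

Import Order.TTheory GRing.Theory Num.Theory.
Import numFieldNormedType.Exports.

Local Open Scope classical_set_scope.
Local Open Scope ring_scope.

(* [borel X] is X with its topology and the sigma-algebra generated by its
   open sets. *)
Definition borel (X : ptopologicalType) : Type := g_sigma_algebraType (@open X).
HB.instance Definition _ (X : ptopologicalType) :=
  Measurable.copy (borel X) (g_sigma_algebraType (@open X)).
HB.instance Definition _ (X : ptopologicalType) :=
  Topological.copy (borel X) X.

(* [subsp S0] is S as a subspace of X: [set_type S] carries the relative
   topology. The proof of nonemptiness only serves to choose the default point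
   that the library requires of every measurable type. *)
Definition subsp (X : topologicalType) (S : set X) (S0 : S !=set0) : Type :=
  set_type S.
HB.instance Definition _ (X : topologicalType) (S : set X) (S0 : S !=set0) :=
  Topological.copy (subsp S0) (set_type S).
HB.instance Definition _ (X : topologicalType) (S : set X) (S0 : S !=set0) :=
  isPointed.Build (subsp S0)
    (let: exist s Ss := cid S0 in exist _ s (mem_set Ss)).

(* [`|u|] on ['cV[R]_d] is the maximum norm, hence this definition. *)
Definition enorm (R : realType) (d : nat) (u : 'cV[R]_d) : R :=
  Num.sqrt (\sum_(i < d) u i ord0 ^+ 2).

Section MarkovRewardProcess.
Context {dd : measure_display} {T : measurableType dd} {R : realType}.

Definition mx_integral (m n : nat) (mu : {measure set T -> \bar R})
    (F : T -> 'M[R]_(m, n)) : 'M[R]_(m, n) :=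
  \matrix_(i < m, j < n) \int[mu]_s F s i j.

Definition stationary (p : R.-pker T ~> T) (mu : probability T R) : Prop :=
  forall Z : set T, measurable Z -> mu Z = (\int[mu]_s p s Z)%E.

(* Uniqueness is required on measurable sets only: the library's measures are
   functions on all sets, unconstrained outside the sigma-algebra. *)
Definition unique_stationary (p : R.-pker T ~> T) (mu : probability T R) :
    Prop :=
  stationary p mu /\
  forall nu : probability T R, stationary p nu ->
    forall Z : set T, measurable Z -> nu Z = mu Z.

Definition transition_op (d : nat) (p : R.-pker T ~> T) (f : T -> 'cV[R]_d)
    (s : T) : 'cV[R]_d :=
  mx_integral (p s) f.

Definition td_A (d : nat) (p : R.-pker T ~> T) (mu : probability T R)
    (gamma : R) (x : T -> 'cV[R]_d) : 'M[R]_d :=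
  mx_integral mu
    (fun s => x s *m (gamma *: (transition_op p x s)^T - (x s)^T)).

Definition td_b (d : nat) (mu : probability T R) (r : T -> R)
    (x : T -> 'cV[R]_d) : 'cV[R]_d :=
  mx_integral mu (fun s => r s *: x s).

Definition td_solutions (d : nat) (p : R.-pker T ~> T) (mu : probability T R)
    (gamma : R) (r : T -> R) (x : T -> 'cV[R]_d) : set 'cV[R]_d :=
  [set w | td_A p mu gamma x *m w + td_b mu r x = 0].

Definition linear_value (d : nat) (x : T -> 'cV[R]_d) (w : 'cV[R]_d) (s : T) :
    R :=
  ((x s)^T *m w) ord0 ord0.

End MarkovRewardProcess.

(* Main.v *)
(** Since A w + b = 0, the vector w' solves the same equation iff A u = 0 for
    u = w - w', and v_u = v_w - v_w'. If v_u = 0 a.e., stationarity gives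
    int P|v_u| dmu = int |v_u| dmu = 0, so every entry of
    A u = int x (gamma P v_u - v_u) dmu vanishes. Conversely A u = 0 gives
    0 = u^T A u = gamma int v_u P v_u dmu - int v_u^2 dmu. Integrating
    2 v(s) v(t) <= v(s)^2 + v(t)^2 against p(dt|s) mu(ds), whose two marginals
    are mu, yields int v P v dmu <= int v^2 dmu, so
    (1 - gamma) int v_u^2 dmu <= 0 and v_u = 0 a.e. *)
Require Import Defs.
From HB Require Import structures.
From mathcomp Require Import all_boot all_order all_algebra.
From mathcomp Require Import all_classical all_reals all_analysis.
From mathcomp Require Import measurable_realfun giry.
From mathcomp Require Import ring lra.

Set Implicit Arguments.
Unset Strict Implicit.
Unset Printing Implicit Defensive.

Import Order.TTheory GRing.Theory Num.Theory.
Import numFieldNormedType.Exports.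

Local Open Scope classical_set_scope.
Local Open Scope ring_scope.

(** * Calculus of bounded measurable functions *)

Section BoundedMeasurable.
Context {dd : measure_display} {T : measurableType dd} {R : realType}.
Implicit Types (f g : T -> R) (P : {measure set T -> \bar R}).

(** This class is stable under the algebraic operations and under the kernel, and its members are
    integrable for every measure of mass one, so it settles all integrability side conditions
    below. *)
Definition bounded_measurable f : Prop :=
  measurable_fun setT f /\ exists M, forall s, `|f s| <= M.

Lemma bounded_measurable_cst c : bounded_measurable (fun=> c).
Proof. by split; [exact: measurable_cst|exists `|c|]. Qed.

Lemma bounded_measurableD f g : bounded_measurable f -> bounded_measurable g ->
  bounded_measurable (fun s => f s + g s).
Proof.
move=> [mf [M fM]] [mg [N gN]]; split; first exact: measurable_funD.
by exists (M + N) => s; rewrite (le_trans (ler_normD _ _))// lerD.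
Qed.

Lemma bounded_measurableM f g : bounded_measurable f -> bounded_measurable g ->
  bounded_measurable (fun s => f s * g s).
Proof.
move=> [mf [M fM]] [mg [N gN]]; split; first exact: measurable_funM.
by exists (M * N) => s; rewrite normrM ler_pM.
Qed.

Lemma bounded_measurableZ c f : bounded_measurable f ->
  bounded_measurable (fun s => c * f s).
Proof. exact/bounded_measurableM/bounded_measurable_cst. Qed.

Lemma bounded_measurableB f g : bounded_measurable f -> bounded_measurable g ->
  bounded_measurable (fun s => f s - g s).
Proof.
move=> bf [mg [N gN]]; apply: bounded_measurableD => //; split.
  exact: measurableT_comp.
by exists N => s; rewrite normrN.
Qed.

Lemma bounded_measurable_norm f : bounded_measurable f ->
  bounded_measurable (fun s => `|f s|).
Proof.
move=> [mf [M fM]]; split; first exact: measurableT_comp.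
by exists M => s; rewrite normr_id.
Qed.

Lemma bounded_measurable_sum (I : Type) (r : seq I) (F : I -> T -> R) :
  (forall i, bounded_measurable (F i)) ->
  bounded_measurable (fun s => \sum_(i <- r) F i s).
Proof.
move=> bF; elim: r => [|i r IH].
  by under eq_fun do rewrite big_nil; exact: bounded_measurable_cst.
by under eq_fun do rewrite big_cons; exact: bounded_measurableD.
Qed.

(** Total mass one is a hypothesis on a plain measure, so that the result applies both to [mu] and
    to each [p s]. *)
Lemma bounded_measurable_integrable P f : P setT = 1%E -> bounded_measurable f ->
  P.-integrable setT (EFin \o f).
Proof.
move=> P1 [mf [M fM]]; apply: measurable_bounded_integrable => //.
  by rewrite P1 ltry.
exists M; split; first exact: num_real.
by move=> N MN s _ /=; exact: le_trans (fM s) (ltW MN).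
Qed.

Lemma Rintegral_sum P (I : Type) (r : seq I) (F : I -> T -> R) :
  P setT = 1%E -> (forall i, bounded_measurable (F i)) ->
  \int[P]_s (\sum_(i <- r) F i s) = \sum_(i <- r) \int[P]_s F i s.
Proof.
move=> P1 bF; elim: r => [|i r IH].
  by under eq_Rintegral do rewrite big_nil; rewrite big_nil Rintegral_cst// mul0r.
under eq_Rintegral do rewrite big_cons.
rewrite big_cons RintegralD ?IH//; apply: bounded_measurable_integrable => //.
exact: bounded_measurable_sum.
Qed.

Lemma Rintegral_le_bounded P f g :
  P setT = 1%E -> bounded_measurable f -> bounded_measurable g ->
  (forall s, f s <= g s) -> \int[P]_s f s <= \int[P]_s g s.
Proof.
by move=> P1 bf bg fg; apply: le_Rintegral => //;
  exact: bounded_measurable_integrable.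
Qed.

Lemma Rintegral_normr_bound P f M : P setT = 1%E -> bounded_measurable f ->
  (forall s, `|f s| <= M) -> `|\int[P]_s f s| <= M.
Proof.
move=> P1 bf fM; have M_cst : \int[P]_s M = M.
  by rewrite Rintegral_cst// P1 mulr1.
apply: le_trans (le_normr_Rintegral _ _) _ => //.
  exact: bounded_measurable_integrable.
rewrite -[leRHS]M_cst; apply: Rintegral_le_bounded => //.
- exact: bounded_measurable_norm.
- exact: bounded_measurable_cst.
Qed.

Lemma bounded_measurable_kernel (p : R.-pker T ~> T) f :
  bounded_measurable f -> bounded_measurable (fun s => \int[p s]_t f t).
Proof.
move=> bf; split; last first.
  by have [mf [M fM]] := bf; exists M => s;
    exact/Rintegral_normr_bound/fM/bf/prob_kernel.
have [mf _] := bf; have mEf : measurable_fun setT (EFin \o f).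
  exact/measurable_EFinP.
apply: measurableT_comp => //.
(* Kernel integrals depend measurably on [s] for nonnegative integrands, hence the split into
   positive and negative parts. *)
have -> : (fun s => \int[p s]_t (f t)%:E)%E =
    (fun s => \int[p s]_t (EFin \o f)^\+ t - \int[p s]_t (EFin \o f)^\- t)%E.
  by apply/funext => s; rewrite integralE.
apply: emeasurable_funB; apply: measurable_fun_integral_kernel => //.
- by move=> U mU; exact: measurable_kernel.
- exact: measurable_funepos.
- by move=> U mU; exact: measurable_kernel.
- exact: measurable_funeneg.
Qed.

End BoundedMeasurable.

(** * Stationarity and the quadratic form of A *)

Section Stationary.
Context {dd : measure_display} {T : measurableType dd} {R : realType}.

(* The library makes [p s] a measure only; [kernel_law p s] is the same function
   with its probability structure, so that it lives in the Giry space. *)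
Definition kernel_law (p : R.-pker T ~> T) (s : T) : set T -> \bar R := p s.

HB.instance Definition _ (p : R.-pker T ~> T) (s : T) :=
  Measure.copy (kernel_law p s) (p s).
HB.instance Definition _ (p : R.-pker T ~> T) (s : T) :=
  Measure_isProbability.Build _ _ _ (kernel_law p s) (prob_kernel s).

Variables (p : R.-pker T ~> T) (mu : probability T R).
Hypothesis mu_stat : stationary p mu.
Implicit Types f g v : T -> R.

(** Stationarity says that [mu] is the Giry bind of [mu] with the kernel, and integrating against a
    bind is iterated integration. *)
Lemma stationary_integral (h : T -> \bar R) :
  measurable_fun setT h -> (forall s, 0 <= h s)%E ->
  (\int[mu]_s h s = \int[mu]_s \int[p s]_t h t)%E.
Proof.
move=> mh h0; pose k s : giry T R := kernel_law p s.
have mk : measurable_fun setT k.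
  by apply: measurable_giry_codensity => // B mB; exact: measurable_kernel.
rewrite -[RHS](giry_int_bind (mu : giry T R) mk mh h0).
apply: eq_measure_integral => Z mZ _.
rewrite [RHS](giry_int_map mk mu (measurable_giry_ev mZ))//; exact: mu_stat.
Qed.

Lemma stationary_Rintegral f : bounded_measurable f -> (forall s, 0 <= f s) ->
  \int[mu]_s \int[p s]_t f t = \int[mu]_s f s.
Proof.
move=> bf f0; rewrite /Rintegral [in RHS]stationary_integral//.
- congr fine; apply: eq_integral => s _; rewrite fineK//.
  exact/integrable_fin_num/bounded_measurable_integrable/bf/prob_kernel.
- by apply/measurable_EFinP; case: bf.
Qed.

Let muT : (mu : {measure set T -> \bar R}) setT = 1%E := probability_setT mu.
Let pT s : p s setT = 1%E := prob_kernel s.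

Lemma Rintegral_norm_eq0 f : bounded_measurable f ->
  \int[mu]_s `|f s| = 0 <-> {ae mu, forall s, f s = 0}.
Proof.
move=> bf; have mf : measurable_fun setT (EFin \o f).
  by apply/measurable_EFinP; case: bf.
have -> : (\int[mu]_s `|f s| = 0) <->
    (\int[mu]_s `|(EFin \o f) s| = 0)%E.
  (* Since [fine] also sends infinities to 0, a vanishing real integral is informative only once
     finiteness is known. *)
  have fin : (\int[mu]_s `|(EFin \o f) s|)%E \is a fin_num.
    apply: integrable_fin_num => //.
    exact/(bounded_measurable_integrable muT)/bounded_measurable_norm.
  by split=> [f0|f0]; [rewrite -(fineK fin); congr EFin|rewrite /Rintegral f0].
rewrite ae_eq_integral_abs//; split; apply: filterS => s /=.
  by move=> /(_ Logic.I) [].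
by move=> -> _.
Qed.

(** Expand the square in 0 <= (v s - v t)^2 and integrate over t against [p s], which has mass
    one. *)
Lemma mul_kernel_le v s : bounded_measurable v ->
  v s * \int[p s]_t v t <= 2^-1 * (v s ^+ 2 + \int[p s]_t (v t * v t)).
Proof.
move=> bv; have bvv := bounded_measurableM bv bv.
have cst c := @bounded_measurable_cst _ T R c.
have -> : v s ^+ 2 = \int[p s]_t (v s ^+ 2).
  by rewrite Rintegral_cst// pT mulr1.
have I f := @bounded_measurable_integrable _ _ _ (p s) f (pT s).
rewrite -RintegralD; [|by []|exact: I|exact: I].
rewrite -!RintegralZl; [|by []| |by []|exact: I]; last first.
  exact/I/bounded_measurableD.
apply: Rintegral_le_bounded => //.
- exact: bounded_measurableZ.
- exact/bounded_measurableZ/bounded_measurableD.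
- by move=> t; have := sqr_ge0 (v s - v t); nra.
Qed.

Lemma td_quadratic_form_eq0 gamma v :
  0 <= gamma -> gamma < 1 -> bounded_measurable v ->
  \int[mu]_s (v s * (gamma * \int[p s]_t v t - v s)) = 0 ->
  {ae mu, forall s, v s = 0}.
Proof.
move=> gamma_ge0 gamma_lt1 bv vA0.
have bP f := @bounded_measurable_kernel _ T R p f.
have bvv := bounded_measurableM bv bv.
have I f := @bounded_measurable_integrable _ _ _ mu f muT.
have vv_ge0 : 0 <= \int[mu]_s (v s * v s).
  by apply: Rintegral_ge0 => s _; rewrite -expr2 sqr_ge0.
have vv0 : \int[mu]_s (v s * v s) = 0.
  (* By [mul_kernel_le] this integrand dominates the one in [vA0]. Stationarity turns its integral
     into (gamma - 1) times the integral of v^2, which must therefore vanish. *)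
  have : 0 <= \int[mu]_s (2^-1 * gamma * (\int[p s]_t (v t * v t)) -
                        (1 - 2^-1 * gamma) * (v s * v s)).
    rewrite -[leLHS]vA0; apply: Rintegral_le_bounded => //.
    - apply: bounded_measurableM => //; apply: bounded_measurableB => //.
      exact/bounded_measurableZ/bP.
    - by apply: bounded_measurableB; apply: bounded_measurableZ => //; exact: bP.
    - by move=> s; have := mul_kernel_le s bv; nra.
  have IP := I _ (bP _ bvv).
  have IZ c := I _ (bounded_measurableZ c bvv).
  have IPZ c := I _ (bounded_measurableZ c (bP _ bvv)).
  rewrite RintegralB// !RintegralZl//; last exact: I.
  rewrite stationary_Rintegral// => [|s]; last by rewrite -expr2 sqr_ge0.
  by move=> ?; apply/le_anti/andP; split; nra.
have : {ae mu, forall s, v s * v s = 0}.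
  apply/Rintegral_norm_eq0 => //; rewrite -[RHS]vv0.
  by apply: eq_Rintegral => s _; rewrite ger0_norm// -expr2 sqr_ge0.
by apply: filterS => s /eqP; rewrite mulf_eq0 orbb => /eqP.
Qed.

Lemma td_ae0_eq0 gamma g v :
  bounded_measurable g -> bounded_measurable v ->
  {ae mu, forall s, v s = 0} ->
  \int[mu]_s (g s * (gamma * \int[p s]_t v t - v s)) = 0.
Proof.
move=> bg bv /(Rintegral_norm_eq0 bv) v0; have [_ [M gM]] := bg.
have bP f := @bounded_measurable_kernel _ T R p f.
have bn := bounded_measurable_norm bv.
have I f := @bounded_measurable_integrable _ _ _ mu f muT.
(* The kernel might charge the exceptional null set from some states; stationarity excludes this on
   average over [mu]. *)
have Pv0 : \int[mu]_s \int[p s]_t `|v t| = 0 by rewrite stationary_Rintegral.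
have b : bounded_measurable (fun s => g s * (gamma * \int[p s]_t v t - v s)).
  apply: bounded_measurableM => //; apply: bounded_measurableB => //.
  exact/bounded_measurableZ/bP.
apply/normr0_eq0/le_anti/andP; split; last exact: normr_ge0.
(* A majorant of the absolute integrand, with [M] bounding [g]; both of its terms integrate to 0. *)
have -> : 0 = \int[mu]_s (M * (`|gamma| * \int[p s]_t `|v t| + `|v s|)).
  have bPn := bP _ bn; have bPnZ := bounded_measurableZ `|gamma| bPn.
  rewrite RintegralZl//; last exact/I/bounded_measurableD.
  rewrite RintegralD//; [|exact: I|exact: I].
  rewrite RintegralZl//; last exact: I.
  by rewrite v0 Pv0 !(mulr0, addr0).
apply: le_trans (le_normr_Rintegral _ (I _ b)) _ => //.
apply: Rintegral_le_bounded => //.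
- exact: bounded_measurable_norm.
- exact/bounded_measurableZ/bounded_measurableD/bn/bounded_measurableZ/bP.
- move=> s; rewrite normrM; apply: ler_pM => //.
  rewrite (le_trans (ler_normB _ _))// lerD2r normrM ler_wpM2l//.
  by apply: le_normr_Rintegral => //; exact/bounded_measurable_integrable.
Qed.

End Stationary.

(** * Feature maps and the kernel of the matrix A *)

Section Features.
Context {dd : measure_display} {T : measurableType dd} {R : realType} {d : nat}.
Variable x : T -> borel 'cV[R]_d.
Hypothesis x_meas : measurable_fun setT x.
Hypothesis x_bnd : (ereal_sup [set (enorm (x s))%:E | s in setT] < +oo)%E.

(** Open rays generate the Borel sets of the line, and their preimages under a continuous coordinate
    are open. *)
Lemma measurable_borel_coord i :
  measurable_fun setT (fun u : borel 'cV[R]_d => u i ord0).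
Proof.
apply: (measurability _ (RGenOInfty.measurableE R)) => //.
move=> _ [_ [a ->] <-]; rewrite setTI; apply: sub_sigma_algebra.
have /continuousP := @coord_continuous R d 1 i ord0.
by apply; exact: interval_open.
Qed.

Lemma normr_coord_le_enorm (u : 'cV[R]_d) i : `|u i ord0| <= enorm u.
Proof.
rewrite -sqrtr_sqr ler_sqrt; last by apply: sumr_ge0 => j _; exact: sqr_ge0.
by rewrite (bigD1 i)//= lerDl; apply: sumr_ge0 => j _; exact: sqr_ge0.
Qed.

Lemma feature_coord_bounded i : bounded_measurable (fun s => x s i ord0).
Proof.
split; first exact: measurableT_comp (measurable_borel_coord i) x_meas.
move: (x_bnd); set E := (X in ereal_sup X) => Efin.
have Eub s : ((enorm (x s))%:E <= ereal_sup E)%E.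
  by apply: ereal_sup_ubound; exists s.
exists (fine (ereal_sup E)) => s.
apply: le_trans (normr_coord_le_enorm _ _) _; rewrite -lee_fin fineK//.
(* The value at [point] keeps the supremum above -oo, so [fine] loses nothing. *)
by rewrite fin_numElt Efin andbT (lt_le_trans _ (Eub point)) ?ltNyr.
Qed.

Lemma linear_valueE u s : linear_value x u s = \sum_j x s j ord0 * u j ord0.
Proof. by rewrite /linear_value mxE; apply: eq_bigr => j _; rewrite mxE. Qed.

Lemma linear_value_bounded u : bounded_measurable (linear_value x u).
Proof.
rewrite [X in bounded_measurable X](funext (linear_valueE u)).
apply: bounded_measurable_sum => j; apply: bounded_measurableM.
  exact: feature_coord_bounded.
exact: bounded_measurable_cst.
Qed.

Lemma linear_valueB u u' s :
  linear_value x (u - u') s = linear_value x u s - linear_value x u' s.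
Proof. by rewrite /linear_value mulmxBr !mxE. Qed.

(** Linearity moves [u] inside both integrals, where it meets the features and forms v_u; questions
    about A u become scalar integrals. *)
Lemma td_A_mulE (p : R.-pker T ~> T) (mu : probability T R) gamma u i :
  (td_A p mu gamma x *m u) i ord0 =
  \int[mu]_s (x s i ord0 *
    (gamma * \int[p s]_t linear_value x u t - linear_value x u s)).
Proof.
have bx := feature_coord_bounded.
have muT : (mu : {measure set T -> \bar R}) setT = 1%E := probability_setT mu.
have bA k : bounded_measurable (fun s =>
    x s i ord0 * (gamma * \int[p s]_t x t k ord0 - x s k ord0)).
  apply: bounded_measurableM => //; apply: bounded_measurableB => //.
  exact/bounded_measurableZ/bounded_measurable_kernel.
transitivity (\sum_k \int[mu]_s
    (x s i ord0 * (gamma * \int[p s]_t x t k ord0 - x s k ord0) * u k ord0)).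
  rewrite mxE; apply: eq_bigr => k _; rewrite RintegralZr//; last first.
    exact: bounded_measurable_integrable.
  rewrite mxE; congr (_ * _); apply: eq_Rintegral => s _.
  by rewrite mxE big_ord1 !mxE.
rewrite -Rintegral_sum// => [|k]; last first.
  exact/bounded_measurableM/bounded_measurable_cst.
apply: eq_Rintegral => s _.
have -> : \int[p s]_t linear_value x u t =
    \sum_k (\int[p s]_t x t k ord0) * u k ord0.
  under eq_Rintegral do rewrite linear_valueE.
  rewrite Rintegral_sum; first last.
  - by move=> k; exact/bounded_measurableM/bounded_measurable_cst.
  - exact: prob_kernel.
  apply: eq_bigr => k _; rewrite RintegralZr//.
  exact/bounded_measurable_integrable/bx/prob_kernel.
rewrite linear_valueE mulr_sumr -sumrB mulr_sumr; apply: eq_bigr => k _.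
by ring.
Qed.

Lemma td_A_mul_eq0 (p : R.-pker T ~> T) (mu : probability T R) gamma u :
  stationary p mu -> 0 <= gamma -> gamma < 1 ->
  td_A p mu gamma x *m u = 0 <-> {ae mu, forall s, linear_value x u s = 0}.
Proof.
move=> mu_stat gamma_ge0 gamma_lt1; have bv := linear_value_bounded u.
split=> [Au0|v0]; last first.
  apply/matrixP => i j; rewrite ord1 td_A_mulE mxE.
  exact: td_ae0_eq0 (feature_coord_bounded i) bv v0.
apply: (td_quadratic_form_eq0 mu_stat gamma_ge0 gamma_lt1 bv).
have muT : (mu : {measure set T -> \bar R}) setT = 1%E := probability_setT mu.
set D := fun s => gamma * \int[p s]_t linear_value x u t - linear_value x u s.
have bD : bounded_measurable D.
  apply: bounded_measurableB => //.
  exact/bounded_measurableZ/bounded_measurable_kernel.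
have bxD i := bounded_measurableM (feature_coord_bounded i) bD.
(* The goal is u^T A u = 0. Only the outer factor v_u is expanded in coordinates; [D] stays whole,
   so that each summand is a coordinate of A u weighted by that of [u]. *)
transitivity (\int[mu]_s \sum_i u i ord0 * (x s i ord0 * D s)).
  apply: eq_Rintegral => s _; rewrite {1}linear_valueE mulr_suml.
  by apply: eq_bigr => i _; rewrite mulrAC mulrC.
rewrite Rintegral_sum// => [|i]; last exact: bounded_measurableZ.
rewrite big1// => i _; rewrite RintegralZl//; last first.
  exact: bounded_measurable_integrable.
by rewrite -td_A_mulE Au0 mxE mulr0.
Qed.

End Features.

Theorem lemma5 (R : realType) (K d : nat)
    (S : set 'cV[R]_K) (S0 : S !=set0)
    (p : R.-pker (borel (subsp S0)) ~> (borel (subsp S0)))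
    (r : borel (subsp S0) -> R) (r_meas : measurable_fun setT r)
    (gamma : R) (gamma_ge0 : 0 <= gamma) (gamma_lt1 : gamma < 1)
    (x : borel (subsp S0) -> borel 'cV[R]_d) (x_meas : measurable_fun setT x)
    (mu : probability (borel (subsp S0)) R)
    (mu_stat : unique_stationary p mu)
    (mu_open : forall U : set (borel (subsp S0)),
      open U -> U !=set0 -> (0 < mu U)%E)
    (x_bnd : (ereal_sup [set (enorm (x s))%:E | s in setT] < +oo)%E)
    (r_bnd : (ereal_sup [set `|r s|%:E | s in setT] < +oo)%E)
    (w w' : 'cV[R]_d) (w_sol : td_solutions p mu gamma r x w) :
  {ae mu, forall s, linear_value x w s = linear_value x w' s} <->
  td_solutions p mu gamma r x w'.
Proof.
have [stat_p _] := mu_stat.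
have -> : td_solutions p mu gamma r x w' <->
    td_A p mu gamma x *m (w - w') = 0.
  (* As [w] is a solution, b can be eliminated, leaving a homogeneous equation in w - w'. *)
  have bE : td_b mu r x = - (td_A p mu gamma x *m w).
    by apply/eqP; rewrite -addr_eq0 addrC; exact/eqP.
  by rewrite /td_solutions /= bE mulmxBr; split=> /subr0_eq ->; exact: subrr.
rewrite (td_A_mul_eq0 x_meas x_bnd _ stat_p gamma_ge0 gamma_lt1).
split; apply: filterS => s; rewrite linear_valueB => /eqP.
  by rewrite -subr_eq0 => /eqP.
by rewrite subr_eq0 => /eqP.
Qed.
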